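(* Let $u,v\in C_0^+(\mathbb{Z}^d)$ be admissible, $u^*=R_{\mathbb{Z}^d}u$, $v^*=R_{\mathbb{Z}^d}v$, and let $G:\mathbb{R}_+\times\mathbb{R}_+\to\mathbb{R}_+$ be a supermodular function with $G(0,0)=0$. Then $$\sum_{x\in\mathbb{Z}^d}G(u(x),v(x))\le\sum_{x\in\mathbb{Z}^d}G(u^*(x),v^*(x)).$$ Moreover, if $u=u^*$ with $\operatorname{ran}(u)=[a_1>a_2>\cdots]$, $G$ is strictly supermodular, and $\left|\sum_{x\in\mathbb{Z}^d}G(u^*(x),v^*(x))\right|<\infty$, then equality holds if and only if $v=v^*$.
   Context: $\mathbb{R}_+=[0,\infty)$, $d\ge1$ is an integer, $e_i$ is the $i$-th standard unit vector, $\langle\cdot,\cdot\rangle$ the Euclidean inner product. Sums of nonnegative terms take values in $[0,\infty]$. Supermodular: $G(s+s_0,t+t_0)+G(s,t)\ge G(s,t+t_0)+G(s+s_0,t)$ for all $s,t,s_0,t_0\ge0$; strictly supermodular if moreover the inequality is strict whenever $s_0,t_0>0$. Admissible functions: $u\in C_0^+(\mathbb{Z}^d)$ means $u:\mathbb{Z}^d\to\mathbb{R}_+$ with $\{u>t\}$ finite for all $t>0$ (similarly on $\mathbb{Z}$ or $\mathbb{Z}+1/2$). The $n$-th largest value of $u$ is $a_n=\sup_{|\Omega|=n}\min_{\Omega}u$, $n\ge1$; $\operatorname{ran}(u)=[a_1>a_2>\cdots]$ means that $a_n>a_{n+1}$ for all $n\ge1$. One-dimensional rearrangement: for $w$ admissible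 on $\mathbb{Z}$ or on $\mathbb{Z}+1/2$ with largest values $a_1\ge a_2\ge\cdots$ (with multiplicity), $R_{\mathbb{Z}}w(x)=a_{1-2x}$ if $x\le0$ and $R_{\mathbb{Z}}w(x)=a_{2x}$ if $x>0$. Rearrangement on $\mathbb{Z}^d$: let $\vec E=\{e_i,\frac{e_i+e_j}{2},\frac{e_i-e_j}{2}:1\le i<j\le d\}$ (all $e_i$, $1\le i\le d$, included). For $e\in\vec E$, partition $\mathbb{Z}^d$ into the classes of the relation ''$x-y$ is parallel to $e$''; on each class $V$ the map $x\mapsto\langle e,x\rangle$ is a bijection onto $\mathbb{Z}$ or $\mathbb{Z}+1/2$, and the one-step rearrangement $R_eu$ is defined by $(R_eu)|_V=R_{\mathbb{Z}}(u|_V)$ under this identification. Fix an enumeration of $\vec E$ (for $d=2$: $e_1,e_2,\frac{e_1+e_2}{2},\frac{e_1-e_2}{2}$); $R^ku$ is obtained from $u$ by applying successively the first $k$ of the operators $R_e$ in the sequence obtained by repeating this enumeration cyclically. The Schwarz rearrangement is $R_{\mathbb{Z}^d}u(x)=\lim_{k\to\infty}R^ku(x)$, $x\in\mathbb{Z}^d$ (the limit exists). *)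

(* Defs.v *)
From HB Require Import structures.
From mathcomp Require Import all_boot all_order all_algebra finmap.
From mathcomp Require Import all_classical all_reals all_analysis.
Import Order.TTheory GRing.Theory Num.Theory.
Import numFieldNormedType.Exports.

Set Implicit Arguments.
Unset Strict Implicit.
Unset Printing Implicit Defensive.

Local Open Scope classical_set_scope.
Local Open Scope ring_scope.

(* A function G : R_+ x R_+ -> R_+ is represented by G : R -> R -> R; only its
   values at nonnegative arguments are ever constrained or used. *)
Definition supermodular (R : realType) (G : R -> R -> R) : Prop :=
  forall s t s0 t0 : R, 0 <= s -> 0 <= t -> 0 <= s0 -> 0 <= t0 ->
    G s (t + t0) + G (s + s0) t <= G (s + s0) (t + t0) + G s t.

Definition strictly_supermodular (R : realType) (G : R -> R -> R) : Prop :=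
  supermodular G /\
  forall s t s0 t0 : R, 0 <= s -> 0 <= t -> 0 < s0 -> 0 < t0 ->
    G s (t + t0) + G (s + s0) t < G (s + s0) (t + t0) + G s t.

Definition admissible (R : realType) (T : Type) (u : T -> R) : Prop :=
  (forall x, 0 <= u x) /\
  (forall t : R, 0 < t -> finite_set [set x | t < u x]).

Definition is_min_on (R : realType) (T : choiceType) (u : T -> R)
    (Omega : {fset T}) (m : R) : Prop :=
  (exists2 x, x \in Omega & u x = m) /\ (forall y, y \in Omega -> m <= u y).

(* The n-th largest value of the restriction of u to V, for n >= 1. *)
Definition nth_largest (R : realType) (T : choiceType) (V : set T)
    (u : T -> R) (n : nat) : R :=
  sup [set m | exists Omega : {fset T},
         [/\ [set` Omega] `<=` V, #|` Omega| = n & is_min_on u Omega m]].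

(* One-dimensional rearrangement of the restriction of w to V, where V is
   identified with Z or Z + 1/2 through the coordinate pos; the arguments of
   truncn are then positive integers. *)
Definition rearrZ (R : realType) (T : choiceType) (V : set T) (pos : T -> R)
    (w : T -> R) (x : T) : R :=
  if pos x <= 0 then nth_largest V w (Num.truncn (1 - 2 * pos x))
  else nth_largest V w (Num.truncn (2 * pos x)).

Definition unit_vec (R : realType) (d : nat) (i : 'I_d) : 'rV[R]_d :=
  delta_mx 0 i.

Definition directions (R : realType) (d : nat) : set 'rV[R]_d :=
  [set e | (exists i : 'I_d, e = unit_vec R i) \/
           (exists i j : 'I_d, (i < j)%N /\
              (e = 2^-1 *: (unit_vec R i + unit_vec R j) \/
               e = 2^-1 *: (unit_vec R i - unit_vec R j)))].

Definition enumerates_directions (R : realType) (d : nat)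
    (E : seq 'rV[R]_d) : Prop :=
  uniq E /\ (forall e, e \in E <-> directions e).

Definition to_real (R : realType) (d : nat) (x : 'rV[int]_d) : 'rV[R]_d :=
  map_mx intr x.

Definition inner (R : realType) (d : nat) (e y : 'rV[R]_d) : R :=
  \sum_(i < d) e 0 i * y 0 i.

Definition line_class (R : realType) (d : nat) (e : 'rV[R]_d)
    (x : 'rV[int]_d) : set 'rV[int]_d :=
  [set y | exists c : R, to_real R (x - y) = c *: e].

Definition rearr_step (R : realType) (d : nat) (e : 'rV[R]_d)
    (u : 'rV[int]_d -> R) (x : 'rV[int]_d) : R :=
  rearrZ (line_class e x) (fun y => inner e (to_real R y)) u x.

Fixpoint rearr_iter (R : realType) (d : nat) (E : seq 'rV[R]_d) (k : nat)
    (u : 'rV[int]_d -> R) : 'rV[int]_d -> R :=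
  if k is k'.+1 then
    rearr_step (nth 0 E (k' %% size E)) (rearr_iter E k' u)
  else u.

Definition schwarz (R : realType) (d : nat) (E : seq 'rV[R]_d)
    (u : 'rV[int]_d -> R) (x : 'rV[int]_d) : R :=
  lim (rearr_iter E k u x @[k --> \oo]).

(* Main.v *)
Require Import Defs.
From HB Require Import structures.
From mathcomp Require Import all_boot all_order all_algebra finmap.
From mathcomp Require Import all_classical all_reals all_analysis.
From mathcomp Require Import zify ring lra.
Import Order.TTheory GRing.Theory Num.Theory.
Import numFieldNormedType.Exports.

Set Implicit Arguments.
Unset Strict Implicit.
Unset Printing Implicit Defensive.

Local Open Scope classical_set_scope.
Local Open Scope ring_scope.

(** Everything is read off the superlevel sets [level u t], that is the sets
    [u >= t] with [0 < t], which are finite when [u] is admissible.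

    The geometric point is that all the one-step rearrangements sort towards
    the same centre. Let [sqdist x] be the squared distance from
    [(2 * d + 1) *: x] to [pole = (d, d - 1, ..., 1)]. The rescaled centre has
    coordinates in the interval from 0 to 1/2, and they decrease strictly; so
    on a line in any of the directions, moving away from this centre meets the
    points at the positions 0, 1, -1, 2, -2, ... (or 1/2, -1/2, 3/2, ...), which
    is the order used by the one-dimensional rearrangement ([sqdist_rank]). One
    step therefore replaces, on each line, the points of a level set by equally
    many points that come first on this line ([level_rearr_step],
    [in_rearr_set]). This operation on finite sets preserves cardinality and
    inclusion, and it lowers the sum of [sqdist] unless it does nothing
    ([energy_rearr_set]).

    As that sum is a natural number, the level sets of the iterates become
    stationary. Hence the iterates converge, the level sets of the limit are
    the stationary sets, and they are fixed by every one-step rearrangement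
    ([level_schwarz], [level_schwarz_fixed]).

    Preservation of cardinality and inclusion gives
    [#|A `&` B| <= #|A' `&` B'|] for the rearranged sets [A'] and [B'], so the
    rearrangement keeps the sizes of all level sets and does not decrease the
    sizes of the intersections of those of [u] with those of [v]. A supermodular
    function that vanishes on both axes is, on any finite grid of arguments, a
    nonnegative combination of indicators of quadrants [a <= s /\ b <= t], so
    its sum does not decrease either ([le_esum_supermodular]). A general [G]
    differs from such a function by [G s 0 + G 0 t], whose sum depends only on
    the sizes of the level sets of [u] and of [v] ([le_esum_equimeasurable]).

    For the equality case, suppose that [v] differs from its rearrangement, and
    consider the first step that modifies [v]. On some line of this step there
    are points [x] before [y] with [v x < v y]. Exchanging these two values
    does not affect the outcome of the step, so the exchanged function still
    satisfies the inequality just proved; but since [u y < u x], strict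
    supermodularity makes the exchange increase the sum strictly
    ([lt_esum_schwarz]). The inequality [u y < u x] needs [u] to be injective,
    thus to have no zero: its support is infinite and is stable under moves
    towards the centre along the lines, and from far enough such moves lead to
    any given point ([exhaustion]). *)

(** * Sorting a finite set along lines *)

Lemma ltn_card_fset (T : choiceType) (A B : {fset T}) :
  {subset A <= B} -> (exists2 x, x \in B & x \notin A) ->
  (#|` A| < #|` B|)%N.
Proof.
move=> /fsubsetP AB BA; apply: fproper_ltn_card; rewrite fproperE AB /=.
exact/fsubsetPn.
Qed.

(** The structure that a direction puts on the lattice: a partition into lines,
    each of them numbered bijectively by the natural numbers. *)
Record ranking (T : Type) (line : rel T) (rank : T -> nat) : Prop := Ranking {
  line_equiv : equivalence_rel line;
  rank_onto : forall x n, exists2 y, line x y & rank y = n;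
  rank_inj : forall x y, line x y -> rank x = rank y -> x = y }.

Section RearrangeSet.
Local Open Scope fset_scope.
Local Open Scope nat_scope.
Variables (T : choiceType) (line : rel T) (rank : T -> nat).

Definition line_part (A : {fset T}) (x : T) : {fset T} :=
  [fset y in A | line x y].

Definition line_point (x : T) (n : nat) : T :=
  xget x [set y | line x y /\ rank y = n]%classic.

Definition below (A : {fset T}) (x : T) : nat :=
  #|` [fset y in line_part A x | rank y < rank x]|.

(** Describing the rearranged set as the image of [A] under an injection that
    never increases the rank gives its cardinality and its energy at once. *)
Definition sort_point (A : {fset T}) (x : T) : T := line_point x (below A x).

Definition rearr_set (A : {fset T}) : {fset T} :=
  [fset sort_point A x | x in A].

Definition down_closed (A : {fset T}) : Prop :=
  forall x y, line x y -> rank x < rank y -> y \in A -> x \in A.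

Hypothesis rk : ranking line rank.

Lemma line_sym x y : line x y = line y x.
Proof.
case: rk => h _ _; apply/idP/idP => l.
  by rewrite -(h x y x).2// (h x y x).1.
by rewrite -(h y x y).2// (h y x y).1.
Qed.

Lemma line_left x y z : line x y -> line x z = line y z.
Proof. by case: rk => h _ _; exact: (h x y z).2. Qed.

Lemma in_line_part A x y : (y \in line_part A x) = (y \in A) && line x y.
Proof. by rewrite !inE. Qed.

Lemma line_part_eq A x y : line x y -> line_part A x = line_part A y.
Proof.
by move=> l; apply/fsetP => z; rewrite !in_line_part (line_left z l).
Qed.

Lemma line_pointP x n : line x (line_point x n) /\ rank (line_point x n) = n.
Proof.
have [y l r] := rank_onto rk x n.
exact: (xgetPex x (ex_intro (fun y => line x y /\ rank y = n) y (conj l r))).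
Qed.

Lemma line_sort_point A x : line x (sort_point A x).
Proof. by case: (line_pointP x (below A x)). Qed.

Lemma rank_sort_point A x : rank (sort_point A x) = below A x.
Proof. by case: (line_pointP x (below A x)). Qed.

Lemma below_lt A x y : x \in A -> line x y -> rank x < rank y ->
  below A x < below A y.
Proof.
move=> xA l r; apply: ltn_card_fset.
  move=> z; rewrite !inE /= => /andP[/andP[-> lz] rz].
  by rewrite -(line_left z l) lz (ltn_trans rz r).
by exists x; rewrite !inE /= ?ltnn ?andbF// xA line_sym l r.
Qed.

Lemma sort_point_inj A : {in A &, injective (sort_point A)}.
Proof.
move=> x y xA yA e.
have l : line x y.
  by rewrite (line_left y (line_sort_point A x)) e line_sym line_sort_point.
have b : below A x = below A y by rewrite -!rank_sort_point e.
apply: (rank_inj rk l); case: (ltngtP (rank x) (rank y)) => // r.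
  by have := below_lt xA l r; rewrite b ltnn.
by have := below_lt yA _ r; rewrite line_sym l b ltnn => /(_ isT).
Qed.

Lemma card_rearr_set A : #|` rearr_set A| = #|` A|.
Proof. by apply: card_in_imfset => x y /= xA yA; apply: sort_point_inj. Qed.

Lemma card_rank_lt (A : {fset T}) n x :
  (forall y, y \in A -> line x y /\ rank y < n) ->
  #|` A| <= n.
Proof.
move=> h; have <- : #|` [fset rank y | y in A]| = #|` A|.
  apply: card_in_imfset => y z /h[ly _] /h[lz _].
  by apply: (rank_inj rk); rewrite -(line_left z ly).
have -> : n = #|` [fset i in iota 0 n]|.
  by rewrite card_fseq undup_id ?iota_uniq// size_iota.
apply: fsubset_leq_card; apply/fsubsetP => i /imfsetP[y /= yA ->].
by rewrite !inE /= mem_iota /= add0n; case: (h _ yA).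
Qed.

Lemma below_le_rank A x : below A x <= rank x.
Proof.
apply: (@card_rank_lt _ _ x) => y.
by rewrite !inE /= => /andP[/andP[_ ->] ->].
Qed.

Lemma card_line_points x n :
  #|` [fset line_point x i | i in iota 0 n]| = n.
Proof.
rewrite card_in_imfset /=; first by rewrite undup_id ?iota_uniq ?size_iota.
by move=> i j _ _ e; rewrite -(line_pointP x i).2 e (line_pointP x j).2.
Qed.

Lemma below_full A x : (forall y, line x y -> rank y < rank x -> y \in A) ->
  below A x = rank x.
Proof.
move=> h; apply/eqP; rewrite eqn_leq below_le_rank /=.
rewrite -[leqLHS](card_line_points x).
apply: fsubset_leq_card; apply/fsubsetP => y /imfsetP[i /=].
rewrite mem_iota add0n => /= ir ->; have [l r] := line_pointP x i.
by rewrite !inE /= l r ir andbT h // r.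
Qed.

(** On a line that meets [A] in [n] points, the points of [A] are sent
    injectively among the first [n] places, so they fill them. *)
Lemma in_rearr_set A x :
  (x \in rearr_set A) = (rank x < #|` line_part A x|).
Proof.
pose B := line_part A x.
pose I := [fset line_point x i | i in iota 0 #|` B|].
have cI : #|` I| = #|` B| by exact: card_line_points.
have BA : {subset B <= A} by move=> y; rewrite in_line_part => /andP[].
have SI : [fset sort_point A y | y in B] = I.
  have cS : #|` [fset sort_point A y | y in B]| = #|` B|.
    by apply: card_in_imfset => y z /BA yA /BA zA; apply: sort_point_inj.
  apply/eqP; rewrite eqEfcard cI cS leqnn andbT.
  apply/fsubsetP => _ /imfsetP[y /= yB ->].
  move: (yB); rewrite in_line_part => /andP[yA l].
  apply/imfsetP; exists (below A y).
    rewrite /= mem_iota /= add0n; apply: ltn_card_fset.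
      by move=> z; rewrite !inE /= -(line_left z l) => /andP[].
    by exists y => //; rewrite !inE /= ltnn andbF.
  have lx : line x (sort_point A y) by rewrite (line_left _ l) line_sort_point.
  have [lp rp] := line_pointP x (below A y).
  apply: (rank_inj rk); first by rewrite -(line_left _ lx).
  by rewrite rp rank_sort_point.
have -> : (x \in rearr_set A) = (x \in I).
  rewrite -SI; apply/imfsetP/imfsetP => -[y /= yA e]; exists y => //.
    by rewrite in_line_part yA line_sym e line_sort_point.
  by move: yA; rewrite in_line_part => /andP[].
apply/imfsetP/idP => [[i /=]|r].
  by rewrite mem_iota /= add0n => i_lt e; rewrite {1}e (line_pointP x i).2.
exists (rank x); first by rewrite /= mem_iota.
have [lp rp] := line_pointP x (rank x).
exact: (rank_inj rk).
Qed.

Lemma rearr_set_sub A B : A `<=` B -> rearr_set A `<=` rearr_set B.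
Proof.
move=> /fsubsetP AB; apply/fsubsetP => x; rewrite !in_rearr_set => h.
apply: leq_trans h _; apply: fsubset_leq_card; apply/fsubsetP => y.
by rewrite !in_line_part => /andP[/AB -> ->].
Qed.

(** The rearranged intersection has the size of the intersection and is
    contained in both rearranged sets. *)
Lemma card_rearr_setI A B :
  #|` A `&` B| <= #|` rearr_set A `&` rearr_set B|.
Proof.
rewrite -card_rearr_set; apply: fsubset_leq_card.
by rewrite fsubsetI !rearr_set_sub ?fsubsetIl ?fsubsetIr.
Qed.

Lemma rearr_set_down A : down_closed A -> rearr_set A = A.
Proof.
move=> h; have e x : x \in A -> sort_point A x = x.
  move=> xA; apply: (rank_inj rk); first by rewrite line_sym line_sort_point.
  rewrite rank_sort_point below_full// => y l r.
  by apply: (h y x) => //; rewrite line_sym.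
apply/fsetP => x; apply/imfsetP/idP => [[y /= yA ->]|xA]; first by rewrite e.
by exists x; rewrite ?e.
Qed.

Lemma rearr_set_fixed A : rearr_set A = A -> down_closed A.
Proof.
move=> e x y l r; rewrite -{1}e -[in X in _ -> X]e !in_rearr_set.
by rewrite (line_part_eq _ l); apply: ltn_trans.
Qed.

(** Sorting only moves points to places with a smaller rank, so any weight that
    increases with the rank is a Lyapunov function for it. *)
Section Energy.
Variable phi : T -> nat.
Hypothesis phi_lt : forall x y, line x y -> rank x < rank y -> phi x < phi y.

Definition energy (A : {fset T}) : nat := \sum_(x <- A) phi x.

Let phi_sort A x : phi (sort_point A x) <= phi x ?= iff (sort_point A x == x).
Proof.
have l : line (sort_point A x) x by rewrite line_sym line_sort_point.
have [r|r|r] := ltngtP (rank (sort_point A x)) (rank x).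
- have h := phi_lt l r; split; first exact: ltnW.
  rewrite (ltn_eqF h); case: eqP => // e; by rewrite e ltnn in r.
- by move: r; rewrite rank_sort_point ltnNge below_le_rank.
- by rewrite (rank_inj rk l r) eqxx; apply/leqif_refl.
Qed.

Lemma energy_rearr_set A :
  energy (rearr_set A) <= energy A ?= iff (rearr_set A == A).
Proof.
have -> : energy (rearr_set A) = \sum_(x <- A) phi (sort_point A x).
  by rewrite /energy big_imfset//=; apply: sort_point_inj.
have le : \sum_(x <- A) phi (sort_point A x) <= energy A.
  by rewrite leq_sum// => x _; case: (phi_sort A x).
split=> //; apply/eqP/eqP => [e|{le} e]; last first.
  by rewrite -[in RHS]e /energy big_imfset//=; apply: sort_point_inj.
have fx x : x \in A -> sort_point A x = x.
  move=> xA; apply/eqP; rewrite -(phi_sort A x).2; apply/negPn/negP => ne.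
  have lt : phi (sort_point A x) < phi x.
    by rewrite ltn_neqAle ne (phi_sort A x).1.
  suff : \sum_(x <- A) phi (sort_point A x) < energy A by rewrite e ltnn.
  rewrite /energy !(big_fsetD1 x xA) /= -addSn leq_add// leq_sum// => y _.
  by case: (phi_sort A y).
apply/fsetP => x; apply/imfsetP/idP => [[y /= yA ->]|xA]; first by rewrite fx.
by exists x; rewrite ?fx.
Qed.

End Energy.

(** Applied to the level sets of two functions that differ by an exchange of two
    values on one line. *)
Lemma rearr_set_eq A B : (forall x, #|` line_part A x| = #|` line_part B x|) ->
  rearr_set A = rearr_set B.
Proof. by move=> h; apply/fsetP => x; rewrite !in_rearr_set h. Qed.

End RearrangeSet.

(** * Superlevel sets and the largest values *)

Section Levels.
Variables (R : realType) (T : choiceType).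
Implicit Types (u v : T -> R) (t : R).

Definition level u t : {fset T} := fset_set [set x | t <= u x].

Lemma admissible_ge0 u : admissible u -> forall x, 0 <= u x.
Proof. by case. Qed.

Lemma finite_level u t : admissible u -> 0 < t -> finite_set [set x | t <= u x].
Proof.
move=> [_ fin] t0; apply: (sub_finite_set _ (fin (t / 2) _)); last by lra.
by move=> x /=; lra.
Qed.

Lemma in_level u t x : admissible u -> 0 < t -> (x \in level u t) = (t <= u x).
Proof.
move=> au t0; rewrite in_fset_set; last exact: finite_level.
by apply/idP/idP => [/set_mem|?]; last exact: mem_set.
Qed.

Lemma level_inj u v : admissible u -> admissible v ->
  (forall t, 0 < t -> level u t = level v t) -> u = v.
Proof.
move=> au av h; apply/funext => x.
have le f g : admissible f -> admissible g ->
    (forall t, 0 < t -> level f t = level g t) -> f x <= g x.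
  move=> af ag e; have [f0|f0] := ltP 0 (f x); last first.
    exact: le_trans f0 (admissible_ge0 ag x).
  by rewrite -(in_level x ag f0) -e// in_level.
by apply/eqP; rewrite eq_le !le// => t t0; rewrite h.
Qed.

(** The values of an admissible function do not accumulate at a positive number,
    so the threshold can be lowered a little. This turns the limits and suprema
    below into attained ones. *)
Lemma level_gap u t : admissible u -> 0 < t ->
  exists2 r, 0 < r < t & level u r = level u t.
Proof.
move=> au t0.
have gap (s : seq T) : exists2 r, t / 2 <= r < t &
    forall x, x \in s -> r <= u x -> t <= u x.
  elim: s => [|y s [r /andP[r0 rt] h]].
    by exists (t / 2); [apply/andP; split; lra|].
  have [ty|yt] := leP t (u y).
    exists r; first by rewrite r0.
    by move=> x; rewrite inE => /orP[/eqP->//|]; exact: h.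
  exists (Num.max r ((u y + t) / 2)).
    by rewrite le_max r0 /= gt_max rt /=; lra.
  move=> x; rewrite inE ge_max => /orP[/eqP->|xs] /andP[h1 h2]; first by lra.
  exact: h.
have [r /andP[r0 rt] h] := gap (level u (t / 2)).
have r1 : 0 < r by lra.
exists r; first by rewrite r1.
apply/fsetP => x; rewrite !in_level//; apply/idP/idP => [rx|]; last by lra.
by apply: h => //; rewrite in_level//; lra.
Qed.

Lemma admissible_bounded u : admissible u -> exists M, forall x, u x <= M.
Proof.
move=> au; exists (1 + \sum_(y <- level u 1) u y) => x.
have u0 := admissible_ge0 au.
have s0 (A : {fset T}) : 0 <= \sum_(y <- A) u y by apply: sumr_ge0.
have [x1|x1] := leP 1 (u x); last by have := s0 (level u 1); lra.
rewrite (big_fsetD1 x) ?in_level//=.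
by have := s0 (level u 1 `\ x)%fset; lra.
Qed.

Lemma nth_largest_ge0 (V : set T) u n : admissible u -> 0 <= nth_largest V u n.
Proof.
move=> au; rewrite /nth_largest; set S := [set m | _].
have [[m Sm]|] := pselect (exists m, S m); last first.
  move=> h; have -> : S = set0.
    by apply/seteqP; split => // m Sm; apply: h; exists m.
  by rewrite sup0.
apply: le_trans (_ : m <= _).
  by case: Sm => Om [_ _ [[x _ <-] _]]; exact: admissible_ge0.
apply: ub_le_sup => //; have [M hM] := admissible_bounded au.
by exists M => _ [Om [_ _ [[x _ <-] _]]].
Qed.

Lemma le_nth_largest (V : set T) u n t : admissible u -> 0 < t ->
  (t <= nth_largest V u n.+1) =
  (n < #|` [fset x in level u t | x \in V]%fset|)%N.
Proof.
move=> au t0; apply/idP/idP => [le|lt].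
  have [r /andP[r0 rt] er] := level_gap au t0.
  rewrite -er.
  have : r < nth_largest V u n.+1 by exact: lt_le_trans le.
  case/sup_gt.
    apply/set0P/negP => /eqP S0.
    by move: le; rewrite /nth_largest S0 sup0; lra.
  move=> m [Om [OV cO [_ Om_ge]]] rm; rewrite -cO.
  apply: fsubset_leq_card; apply/fsubsetP => x xO.
  rewrite !inE /= in_level// (mem_set (OV x xO)) andbT.
  by apply: le_trans (Om_ge _ xO); exact: ltW.
set A := [fset x in level u t | x \in V]%fset in lt.
have [B BA cB] : exists2 B : {fset T}, (B `<=` A)%fset & #|` B| = n.+1.
  exists [fset x in take n.+1 (enum_fset A)]%fset.
    by apply/fsubsetP => x; rewrite !inE => /mem_take; rewrite !inE.
  by rewrite card_fseq undup_id ?take_uniq ?fset_uniq// size_takel.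
have min (s : seq T) : s != [::] ->
    exists2 x, x \in s & forall y, y \in s -> u x <= u y.
  elim: s => // y s IH _.
  have [->|s0] := eqVneq s [::].
    by exists y; rewrite ?inE// => z; rewrite inE => /eqP->.
  have [x xs hx] := IH s0; have [xy|yx] := leP (u x) (u y).
    by exists x; [rewrite inE xs orbT|move=> z; rewrite inE => /orP[/eqP->//|/hx]].
  exists y; first by rewrite inE eqxx.
  by move=> z; rewrite inE => /orP[/eqP->//|/hx]; apply: le_trans; exact: ltW.
have [x xB hx] : exists2 x, x \in B & forall y, y \in B -> u x <= u y.
  by apply: min; rewrite -size_eq0 cB.
have /fsubsetP BA' := BA.
apply: le_trans (_ : u x <= _).
  by have := BA' _ xB; rewrite !inE /= in_level// => /andP[].
apply: ub_le_sup.
  have [M hM] := admissible_bounded au.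
  by exists M => _ [Om [_ _ [[z _ <-] _]]].
exists B; split=> //; last by split=> //; exists x.
by move=> y /= /BA'; rewrite !inE => /andP[_ /set_mem].
Qed.

End Levels.

(** * The ordering of the lattice lines *)

Section Directions.
Variables (R : realType) (d : nat).
Implicit Types (e : 'rV[R]_d) (x y f : 'rV[int]_d) (u : 'rV[int]_d -> R).

Definition line e : rel 'rV[int]_d := fun x y => `[< line_class e x y >].

(** The index in [rearrZ] of the value placed at [x], shifted to start at 0. *)
Definition rank e x : nat :=
  (if inner e (to_real R x) <= 0 then Num.truncn (1 - 2 * inner e (to_real R x))
   else Num.truncn (2 * inner e (to_real R x))).-1.

Definition dot f x : int := \sum_(j < d) f 0 j * x 0 j.

Definition pole : 'rV[int]_d := \row_(j < d) (d - j)%N%:Z.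

Definition scale : int := (2 * d).+1%:Z.

Definition sqdist x : nat :=
  (\sum_(j < d) `|(scale * x 0 j - pole 0 j)%R| ^ 2)%N.

(** A common form for the three kinds of directions. The real direction is a
    multiple of a primitive integral vector [f] with [k = 2] for a unit vector
    and [k = 1] for a sum or difference of two; then [k * dot f x] is twice the
    position of [x] on its line. The bounds on [k * dot f pole] say that the
    point of the real line closest to the centre has a position strictly
    between 0 and 1/2, which is what breaks the tie between positions [s] and
    [-s]. *)
Record integral_direction e f (k : int) : Prop := IntegralDirection {
  dir_coord : exists i, f 0 i = 1;
  dir_scale : 0 < k;
  dir_norm : k * dot f f = 2;
  dir_pole : 0 < k * dot f pole < scale;
  dir_real : e = (k%:~R / 2) *: to_real R f }.

Lemma dotD f x y : dot f (x + y) = dot f x + dot f y.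
Proof. by rewrite -big_split; apply: eq_bigr => j _; rewrite mxE mulrDr. Qed.

Lemma dotZ f (m : int) x : dot f (m *: x) = m * dot f x.
Proof. by rewrite mulr_sumr; apply: eq_bigr => j _; rewrite mxE mulrCA. Qed.

Lemma dotC x y : dot x y = dot y x.
Proof. by apply: eq_bigr => j _; rewrite mulrC. Qed.

Lemma dotDl f g x : dot (f + g) x = dot f x + dot g x.
Proof. by rewrite !(dotC _ x) dotD. Qed.

Lemma dotZl (m : int) f x : dot (m *: f) x = m * dot f x.
Proof. by rewrite !(dotC _ x) dotZ. Qed.

Lemma dotBl f g x : dot (f - g) x = dot f x - dot g x.
Proof. by rewrite !(dotC _ x) dotD -scaleN1r dotZ mulN1r. Qed.

Lemma dot_delta i x : dot (delta_mx 0 i) x = x 0 i.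
Proof.
rewrite /dot (bigD1 i)//= mxE !eqxx mul1r big1 ?addr0// => j ne.
by rewrite mxE eqxx (negbTE ne) mul0r.
Qed.

Lemma sqdistE x :
  (sqdist x)%:Z = scale ^+ 2 * dot x x - 2 * scale * dot x pole
               + dot pole pole.
Proof.
rewrite /sqdist (big_morph Posz PoszD (erefl _)) !mulr_sumr -sumrB -big_split.
apply: eq_bigr => j _ /=; set a := _ - _.
have -> : (`|a| ^ 2)%N%:Z = a * a.
  by rewrite -mulnn PoszM !abszE -normrM ger0_norm// -expr2 sqr_ge0.
by rewrite /a; ring.
Qed.

Lemma directionsP e : directions e -> exists f k, integral_direction e f k.
Proof.
have cE (i : 'I_d) : pole 0 i = (d - i)%N%:Z by rewrite mxE.
have tr i : to_real R (delta_mx 0 i) = unit_vec R i.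
  by rewrite /to_real map_delta_mx.
have ne (i j : 'I_d) : (i < j)%N -> ((i == j) = false) * ((j == i) = false).
  by move=> ij; rewrite -!val_eqE /= (ltn_eqF ij) (gtn_eqF ij).
move=> [[i ->]|[i [j [ij [->|->]]]]].
- exists (delta_mx 0 i), 2; split => //.
  + by exists i; rewrite mxE !eqxx.
  + by rewrite dot_delta mxE !eqxx.
  + rewrite dot_delta cE /scale; have := ltn_ord i; lia.
  + by rewrite tr divff ?scale1r.
- exists (delta_mx 0 i + delta_mx 0 j), 1; split => //.
  + by exists i; rewrite !mxE !eqxx /= !(ne _ _ ij).
  + rewrite dotDl !dot_delta !mxE !eqxx /=.
    by rewrite !(ne _ _ ij).
  + rewrite dotDl !dot_delta !cE /scale.
    have := ltn_ord i; have := ltn_ord j; lia.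
  + by rewrite /to_real map_mxD !map_delta_mx div1r.
- exists (delta_mx 0 i - delta_mx 0 j), 1; split => //.
  + by exists i; rewrite !mxE !eqxx /= !(ne _ _ ij).
  + rewrite dotBl !dot_delta !mxE !eqxx /=.
    by rewrite !(ne _ _ ij).
  + rewrite dotBl !dot_delta !cE /scale.
    have := ltn_ord i; have := ltn_ord j; lia.
  + by rewrite /to_real map_mxB !map_delta_mx div1r.
Qed.

Section OneDirection.
Variables (e : 'rV[R]_d) (f : 'rV[int]_d) (k : int).
Hypothesis dir : integral_direction e f k.

Definition double_position x : int := k * dot f x.

Lemma double_positionD x m :
  double_position (x + m *: f) = double_position x + 2 * m.
Proof.
rewrite /double_position dotD dotZ mulrDr; congr (_ + _).
by rewrite mulrCA (dir_norm dir) mulrC.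
Qed.

Lemma double_inner x : 2 * inner e (to_real R x) = (double_position x)%:~R.
Proof.
rewrite /double_position rmorphM /= rmorph_sum /= /inner !mulr_sumr.
apply: eq_bigr => j _; rewrite (dir_real dir) !mxE rmorphM /=.
by field.
Qed.

(** Positions 0, 1, -1, 2, ... and 1/2, -1/2, 3/2, ... are numbered 0, 1, 2,
    and so on; in terms of the doubled position both cases read the same. *)
Lemma rankE x :
  rank e x = if double_position x <= 0 then `|double_position x|%N
             else `|double_position x|.-1%N.
Proof.
rewrite /rank double_inner.
have -> : (inner e (to_real R x) <= 0) = (double_position x <= 0).
  by rewrite -(ler_int R) -double_inner pmulr_rle0.
case: (leP (double_position x) 0) => [p0|p0].
  have -> : 1 - (double_position x)%:~R = (`|double_position x|.+1)%:R :> R.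
    rewrite -addn1 natrD addrC; congr (_ + 1).
    by rewrite pmulrn -rmorphN; congr (_%:~R); lia.
  by rewrite natrK.
have {1}-> : (double_position x)%:~R = `|double_position x|%N%:R :> R.
  by rewrite pmulrn; congr (_%:~R); lia.
by rewrite natrK.
Qed.

(** A lattice vector parallel to [f] is an integral multiple of [f], because
    some coordinate of [f] is 1. *)
Lemma lineP x y : reflect (exists m : int, y = x + m *: f) (line e x y).
Proof.
apply: (iffP (asboolP _)) => [[c]|[m ->]]; last first.
  exists (- (2 / k%:~R * m%:~R)).
  rewrite opprD addNKr; apply/matrixP => i j; rewrite (dir_real dir) !mxE.
  rewrite rmorphN rmorphM /= -!mulNr; field.
  by rewrite intr_eq0 gt_eqF// (dir_scale dir).
rewrite (dir_real dir) scalerA; set c' := c * _ => h.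
have [i fi] := dir_coord dir.
exists (y 0 i - x 0 i); apply/matrixP => a j; rewrite !mxE !ord1.
have hj l : (x 0 l - y 0 l)%:~R = c' * (f 0 l)%:~R :> R.
  by move/matrixP/(_ 0 l): h; rewrite !mxE.
have := hj i; rewrite fi mulr1 => ci; have := hj j; rewrite -ci -intrM.
move/eqP; rewrite eqr_int => /eqP h'.
by rewrite -[X in X * _]opprB mulNr -h' subKr.
Qed.

Lemma ranking_line : ranking (line e) (rank e).
Proof.
split.
- move=> x y z; split; first by apply/lineP; exists 0; rewrite scale0r addr0.
  move/lineP => [m ->]; apply/lineP/lineP => -[n ->].
    by exists (n - m); rewrite -addrA -scalerDl addrCA subrr addr0.
  by exists (m + n); rewrite -addrA -scalerDl.
- move=> x n.
  (* The doubled position of the point of rank n has the parity of that of x. *)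
  pose p' : int :=
    if odd n == odd `|double_position x|%N then - n%:Z else n.+1%:Z.
  have [m hm] : exists m, p' = double_position x + 2 * m.
    exists ((p' - double_position x) %/ 2)%Z.
    by rewrite /p'; case: ifP; lia.
  exists (x + m *: f); first by apply/lineP; exists m.
  rewrite rankE double_positionD -hm /p'.
  by case: ifP; case: ifP; lia.
- move=> x y /lineP[m ->]; rewrite !rankE double_positionD => h.
  suff -> : m = 0 by rewrite scale0r addr0.
  by move: h; case: ifP; case: ifP; lia.
Qed.

(** Along the line, [sqdist] is a quadratic polynomial of the doubled position
    [p] that increases with the distance from [p] to
    [k * dot f pole / scale], which lies between 0 and 1. *)
Lemma sqdist_line x m : k * ((sqdist (x + m *: f))%:Z - (sqdist x)%:Z) =
  2 * m * scale * (scale * (double_position x + m) - k * dot f pole).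
Proof.
rewrite !sqdistE !(dotDl, dotD, dotZl, dotZ) (dotC x f) /double_position.
set a := dot x x; set b := dot f x; set c := dot f pole; set n := dot x pole.
have hn : k * dot f f = 2 := dir_norm dir.
transitivity (2 * m * scale * (scale * (k * b) - k * c)
    + scale ^+ 2 * m ^+ 2 * (k * dot f f)).
  by ring.
rewrite hn; ring.
Qed.

Lemma sqdist_rank x y :
  line e x y -> (rank e x < rank e y)%N -> (sqdist x < sqdist y)%N.
Proof.
move=> /lineP[m ->]; rewrite !rankE double_positionD => h.
have := sqdist_line x m; have /andP[g0 gN] := dir_pole dir.
have k0 := dir_scale dir.
have N0 : 0 < scale by [].
set g := k * dot f pole in g0 gN *; set N := scale in N0 gN *.
set p := double_position x in h *.
have pos : 0 < m * (N * (p + m) - g).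
  move: h; case: ifP => h1; case: ifP => h2 h.
  - have m0 : m < 0 by lia. have : p + m < 0 by lia. nia.
  - have m0 : 0 < m by lia. have : 1 <= p + m by lia. nia.
  - have m0 : m < 0 by lia. have : p + m <= 0 by lia. nia.
  - have m0 : 0 < m by lia. have : 1 <= p + m by lia. nia.
move=> eq; rewrite -ltz_nat -subr_gt0 -(pmulr_rgt0 _ k0) eq.
by rewrite [_ * N]mulrAC -mulrA -(mulrA 2); apply: mulr_gt0 => //; nia.
Qed.

End OneDirection.

End Directions.

(** * Convergence of the iterated rearrangements *)

Section Limit.
Variable R : realType.

(** A bounded nonnegative sequence that is eventually on one side of each
    positive threshold converges to the supremum of the thresholds that it
    eventually passes. *)
Lemma cvg_of_thresholds (s : nat -> R) (M : R) :
  (forall k, 0 <= s k <= M) ->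
  (forall t, 0 < t ->
    exists K, forall k, (K <= k)%N -> (t <= s k) = (t <= s K)) ->
  cvg (s k @[k --> \oo]).
Proof.
move=> sM h.
pose S := [set t | t = 0 \/
  (0 < t /\ exists K, forall k, (K <= k)%N -> t <= s k)].
have S0 : S 0 by left.
have supS : has_sup S.
  split; first by exists 0.
  exists M => t [->|[t0 [K hK]]].
    by have /andP[h0 hM] := sM 0%N; apply: le_trans hM.
  by apply: le_trans (hK K (leqnn _)) _; have /andP[] := sM K.
have l0 : 0 <= sup S by apply: ub_le_sup => //; case: supS.
apply/cvg_ex; exists (sup S); apply/cvgrPdist_le => e e0.
have [K1 hK1] := h (sup S + e) (ltr_wpDl l0 e0).
have [K2 hK2] : exists K, forall k, (K <= k)%N -> sup S - e <= s k.
  have [t St lt] := sup_adherent e0 supS.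
  case: St => [t0|[t0 [K hK]]].
    by exists 0%N => k _; have /andP[] := sM k; lra.
  by exists K => k /hK; lra.
have up : s K1 < sup S + e.
  rewrite ltNge; apply/negP => le.
  have : S (sup S + e).
    right; split; first by lra.
    by exists K1 => k /hK1 ->.
  by move/(ub_le_sup supS.2); lra.
exists (maxn K1 K2) => // k /=; rewrite geq_max => /andP[k1 k2].
have := hK2 _ k2; have := hK1 _ k1; rewrite [in RHS]leNgt up /= => /negbT.
by rewrite -ltNge ler_distl; lra.
Qed.

Lemma nonincreasing_stable (f : nat -> nat) :
  (forall k, f k.+1 <= f k)%N -> exists K, forall k, (K <= k)%N -> f k = f K.
Proof.
move=> h.
have [|n /asboolP[K hK] min] := @ex_minnP (fun n => `[< exists k, f k = n >]).
  by exists (f 0); apply/asboolP; exists 0%N.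
exists K => k Kk; apply/eqP; rewrite eqn_leq; apply/andP; split.
  rewrite -(subnKC Kk); elim: (k - K)%N => [|j IH]; first by rewrite addn0.
  by rewrite addnS (leq_trans (h _)).
by rewrite hK min//; apply/asboolP; exists k.
Qed.

End Limit.

Section Schwarz.
Variables (R : realType) (d : nat).
Implicit Types (e : 'rV[R]_d) (x y : 'rV[int]_d) (u v : 'rV[int]_d -> R).

Lemma rearr_stepE e u x : directions e ->
  rearr_step e u x = nth_largest (line_class e x) u (rank e x).+1.
Proof.
move=> /directionsP[f [k dir]]; rewrite /rearr_step /rearrZ /rank.
case: ifP => h; rewrite prednK// truncn_gt0.
  by lra.
move: h; rewrite -(@pmulr_rle0 _ 2)// (double_inner dir).
by rewrite lerz0 ler1z; lia.
Qed.

Definition line_rearr e : {fset 'rV[int]_d} -> {fset 'rV[int]_d} :=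
  rearr_set (line e) (rank e).

Lemma directions_ranking e : directions e -> ranking (line e) (rank e).
Proof. by move=> /directionsP[f [k]]; exact: ranking_line. Qed.

(** The largest value number [n + 1] on a line is at least [t] exactly when the
    level set of [t] has more than [n] points on this line. *)
Lemma rearr_step_ge e u t x : directions e -> admissible u -> 0 < t ->
  (t <= rearr_step e u x) = (x \in line_rearr e (level u t)).
Proof.
move=> de au t0; rewrite rearr_stepE// le_nth_largest// in_rearr_set; last first.
  exact: directions_ranking.
by [].
Qed.

Lemma admissible_rearr_step e u : directions e -> admissible u ->
  admissible (rearr_step e u).
Proof.
move=> de au; split=> [x|t t0].
  by rewrite rearr_stepE//; exact: nth_largest_ge0.
apply: (sub_finite_set _ (finite_fset (line_rearr e (level u t)))) => x /= /ltW.
by rewrite rearr_step_ge.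
Qed.

Lemma level_rearr_step e u t : directions e -> admissible u -> 0 < t ->
  level (rearr_step e u) t = line_rearr e (level u t).
Proof.
move=> de au t0; apply/fsetP => x.
by rewrite in_level ?rearr_step_ge//; exact: admissible_rearr_step.
Qed.

Variable E : seq 'rV[R]_d.
Hypothesis d_gt0 : (0 < d)%N.
Hypothesis dirsE : enumerates_directions E.

Definition dir_at k : 'rV[R]_d := nth 0 E (k %% size E).

Lemma size_directions_gt0 : (0 < size E)%N.
Proof.
have : unit_vec R (Ordinal d_gt0) \in E.
  by apply/(dirsE.2 _); left; exists (Ordinal d_gt0).
by case: E.
Qed.

Lemma directions_at k : directions (dir_at k).
Proof.
by apply/(dirsE.2 _); rewrite mem_nth// ltn_mod size_directions_gt0.
Qed.

Lemma dir_at_onto e K : directions e -> exists2 k, (K <= k)%N & dir_at k = e.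
Proof.
move=> /(dirsE.2 _) eE; exists (K * size E + index e E)%N.
  by rewrite (leq_trans _ (leq_addr _ _))// leq_pmulr// size_directions_gt0.
by rewrite /dir_at modnMDl modn_small ?index_mem// nth_index.
Qed.

Lemma admissible_iter k u : admissible u -> admissible (rearr_iter E k u).
Proof.
move=> au; elim: k => //= k IH.
by apply: admissible_rearr_step => //; exact: directions_at.
Qed.

Lemma level_iterS k u t : admissible u -> 0 < t ->
  level (rearr_iter E k.+1 u) t =
  line_rearr (dir_at k) (level (rearr_iter E k u) t).
Proof.
move=> au t0; apply: level_rearr_step => //; first exact: directions_at.
exact: admissible_iter.
Qed.

Lemma level_iter_eq k u v r t :
  admissible u -> admissible v -> 0 < r -> 0 < t ->
  level u r = level v t ->
  level (rearr_iter E k u) r = level (rearr_iter E k v) t.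
Proof.
by move=> au av r0 t0 e; elim: k => // k IH; rewrite !level_iterS// IH.
Qed.

Lemma card_level_iter k u t : admissible u -> 0 < t ->
  #|` level (rearr_iter E k u) t| = #|` level u t|.
Proof.
move=> au t0; elim: k => // k IH; rewrite level_iterS// -IH.
exact: (card_rearr_set (directions_ranking (directions_at k))).
Qed.

(** The energy is a nonincreasing sequence of natural numbers, hence eventually
    constant, and it stays constant only if the level set does. *)
Lemma level_iter_stable u t : admissible u -> 0 < t ->
  exists K, forall k, (K <= k)%N ->
    level (rearr_iter E k u) t = level (rearr_iter E K u) t.
Proof.
move=> au t0.
pose f k := energy (@sqdist d) (level (rearr_iter E k u) t).
have fS k : (f k.+1 <= f k ?= iff
    (level (rearr_iter E k.+1 u) t == level (rearr_iter E k u) t))%N.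
  rewrite /f level_iterS//; have [g [c dir]] := directionsP (directions_at k).
  exact: (energy_rearr_set (ranking_line dir) (sqdist_rank dir)).
have [K hK] := nonincreasing_stable (fun k => (fS k).1).
exists K => k; elim: k => [|k IH].
  by rewrite leqn0 => /eqP ->.
rewrite leq_eqVlt => /orP[/eqP<-//|]; rewrite ltnS => Kk.
rewrite -IH//; apply/eqP; rewrite -(fS k).2.
by rewrite (hK k Kk) (hK k.+1) // (leq_trans Kk).
Qed.

Lemma cvg_rearr_iter u x : admissible u ->
  cvg (rearr_iter E k u x @[k --> \oo]).
Proof.
move=> au; have ai k := admissible_iter k au.
have [M hM] := admissible_bounded au.
pose M1 := Num.max M 0 + 1.
have M0 : 0 < M1 by rewrite ltr_wpDl// le_max lexx orbT.
apply: (@cvg_of_thresholds _ _ M1) => [k|r r0].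
  rewrite (admissible_ge0 (ai k)) /= leNgt; apply/negP => lt.
  have : x \in level (rearr_iter E k u) M1 by rewrite in_level// ltW.
  have : level u M1 = fset0.
    apply/fsetP => y; rewrite in_level// in_fset0; apply/negbTE; rewrite -ltNge.
    by rewrite (le_lt_trans (hM y))// ltr_pwDr// le_max lexx.
  move=> /(congr1 (fun A : {fset _} => #|` A|)).
  by rewrite -(card_level_iter k)// cardfs0 => /cardfs0_eq->.
have [L hL] := level_iter_stable au r0.
by exists L => k /hL e; rewrite -!in_level// e.
Qed.

(** If [x] is outside the stationary set, the iterates at [x] only stay below
    [t], which bounds their limit by [t]; lowering the threshold by means of
    [level_gap] excludes a limit equal to [t]. *)
Lemma schwarz_ge u t x K : admissible u -> 0 < t ->
  (forall k, (K <= k)%N ->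
    level (rearr_iter E k u) t = level (rearr_iter E K u) t) ->
  (t <= schwarz E u x) = (x \in level (rearr_iter E K u) t).
Proof.
move=> au t0 hK; have ai k := admissible_iter k au.
have cv := @cvg_rearr_iter _ x au.
rewrite in_level//; apply/idP/idP => [le|le].
  rewrite leNgt; apply/negP => lt.
  have [r /andP[r0 rt] er] := level_gap au t0.
  move: le; rewrite leNgt => /negP; apply; apply: le_lt_trans rt.
  apply: limr_le cv _; exists K => // k /= Kk; rewrite leNgt; apply/negP => /ltW.
  rewrite -in_level// (level_iter_eq k au au r0 t0 er) hK// in_level//.
  by rewrite leNgt lt.
apply: limr_ge cv _; exists K => // k /= Kk.
by rewrite -in_level// hK// in_level.
Qed.

Lemma admissible_schwarz u : admissible u -> admissible (schwarz E u).
Proof.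
move=> au; split=> [x|t t0].
  apply: limr_ge (@cvg_rearr_iter _ x au) _; exists 0%N => // k _ /=.
  exact: (admissible_ge0 (admissible_iter k au)).
have [K hK] := level_iter_stable au t0.
apply: (sub_finite_set _ (finite_fset (level (rearr_iter E K u) t))) => x /= /ltW.
by rewrite (schwarz_ge x au t0 hK).
Qed.

Lemma level_schwarz u t : admissible u -> 0 < t ->
  exists K, forall k, (K <= k)%N ->
    level (rearr_iter E k u) t = level (schwarz E u) t.
Proof.
move=> au t0; have [K hK] := level_iter_stable au t0.
exists K => k /hK ->; apply/fsetP => x.
by rewrite (in_level _ (admissible_schwarz au))// (schwarz_ge x au t0 hK).
Qed.

Lemma card_level_schwarz u t : admissible u -> 0 < t ->
  #|` level (schwarz E u) t| = #|` level u t|.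
Proof.
move=> au t0; have [K hK] := level_schwarz au t0.
by rewrite -(hK K)// card_level_iter.
Qed.

Lemma card_levelI_iter_schwarz u v s t k : admissible u -> admissible v ->
  0 < s -> 0 < t ->
  (#|` level (rearr_iter E k u) s `&` level (rearr_iter E k v) t| <=
   #|` level (schwarz E u) s `&` level (schwarz E v) t|)%N%fset.
Proof.
move=> au av s0 t0.
have [K hK] := level_schwarz au s0; have [L hL] := level_schwarz av t0.
pose n := (k + (K + L))%N.
rewrite -(hK n) ?(leq_trans (leq_addr _ _) (leq_addl _ _))//.
rewrite -(hL n) ?(leq_trans (leq_addl _ _) (leq_addl _ _))// /n.
elim: (K + L)%N => [|j IH]; first by rewrite addn0.
rewrite addnS !level_iterS//; apply: leq_trans IH _.
exact: (card_rearr_setI (directions_ranking (directions_at _))).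
Qed.

Lemma level_schwarz_fixed e u t : directions e -> admissible u -> 0 < t ->
  line_rearr e (level (schwarz E u) t) = level (schwarz E u) t.
Proof.
move=> de au t0; have [K hK] := level_schwarz au t0.
have [k Kk <-] := dir_at_onto K de.
by rewrite -[in LHS](hK k)// -level_iterS// hK// (leq_trans Kk).
Qed.

Lemma schwarz_monotone e u x y : directions e -> admissible u ->
  line e x y -> (rank e x < rank e y)%N -> schwarz E u y <= schwarz E u x.
Proof.
move=> de au l r; have as_ := admissible_schwarz au.
have [y0|y0] := ltP 0 (schwarz E u y); last first.
  exact: le_trans y0 (admissible_ge0 as_ _).
rewrite -(in_level x as_)//.
have := rearr_set_fixed (directions_ranking de) (level_schwarz_fixed de au y0).
by move=> /(_ x y l r); apply; rewrite in_level.
Qed.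

Lemma schwarz_fixed u : admissible u ->
  (forall k, rearr_iter E k u = u) -> schwarz E u = u.
Proof.
move=> au h; apply: level_inj => //; first exact: admissible_schwarz.
move=> t t0; have [K hK] := level_schwarz au t0.
by rewrite -(hK K)// h.
Qed.

End Schwarz.

(** * Layer-cake comparison of sums *)

Section LayerCake.
Variable R : realType.

Lemma increasing_enum (s : seq R) :
  exists2 a : seq R, path <%R 0 a & forall z, (z \in a) = (0 < z) && (z \in s).
Proof.
exists (sort <=%R (undup [seq z <- s | 0 < z])) => [|z]; last first.
  by rewrite mem_sort mem_undup mem_filter.
rewrite lt_path_sortedE sort_lt_sorted undup_uniq andbT.
by apply/allP => z; rewrite mem_sort mem_undup mem_filter => /andP[].
Qed.

(** Summing the increments of [h] along the chain up to [s] gives the value of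
    [h] at the last element [c] of the chain below [s]. That [c] does not depend
    on [h] is what allows the use in each variable of a function of two
    variables. *)
Lemma telescope_chain (a : seq R) (a0 s : R) : path <%R a0 a -> a0 <= s ->
  exists c, [/\ a0 <= c <= s, s \in a0 :: a -> c = s &
    forall h : R -> R,
      \sum_(i < size a)
         (h (nth 0 a i) - h (nth 0 (a0 :: a) i)) *+ (nth 0 a i <= s)%R
      = h c - h a0].
Proof.
elim: a a0 => [|a1 a IH] a0 /=.
  move=> _ a0s; exists a0; split; first by rewrite lexx.
    by rewrite inE => /eqP.
  by move=> h; rewrite big_ord0 subrr.
move=> /andP[a01 pa] a0s; have [a1s|sa1] := leP a1 s.
  have [c [/andP[a1c cs] hc hh]] := IH a1 pa a1s.
  exists c; split; first by rewrite cs andbT (le_trans (ltW a01)).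
    by rewrite inE => /orP[/eqP e|/hc//]; lra.
  move=> h; rewrite big_ord_recl /= a1s mulr1n hh.
  by rewrite addrC subrKA.
exists a0; split; first by rewrite lexx.
  rewrite inE => /orP[/eqP//|]; rewrite inE => /orP[/eqP e|sa]; first by lra.
  have := order_path_min lt_trans pa => /allP /(_ _ sa); lra.
move=> h; rewrite subrr big1// => i _.
case: leP => // le; have : a1 <= nth 0 (a1 :: a) i.
  case: i le => -[//|i] /= ia le.
  by have := order_path_min lt_trans pa => /allP /(_ _ (mem_nth 0 _)) /ltW; apply.
by move: le; lra.
Qed.

Variable T : choiceType.
Implicit Types (u v : T -> R).

Lemma le_sum_fset (A B : {fset T}) (f : T -> R) : (A `<=` B)%fset ->
  (forall x, 0 <= f x) -> \sum_(x <- A) f x <= \sum_(x <- B) f x.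
Proof.
move=> AB f0; rewrite [leRHS](big_fsetID _ (mem A)) /=.
have -> : [fset x in B | x \in A]%fset = A.
  by apply/fsetP => x; rewrite !inE /= andbC; apply: andb_idr => /(fsubsetP AB).
by rewrite lerDl sumr_ge0.
Qed.

Lemma sum_nat_fset (A : {fset T}) (P : pred T) :
  (\sum_(x <- A) P x = #|` [fset x in A | P x]%fset|)%N.
Proof.
rewrite card_fset_sum1 -big_fset_condE [RHS]big_mkcond.
by apply: eq_bigr => x _; case: (P x).
Qed.

Lemma le_esum_fset (f g : T -> R) : (forall x, 0 <= g x) ->
  (forall B : {fset T}, exists C : {fset T},
     \sum_(x <- B) f x <= \sum_(x <- C) g x) ->
  (\esum_(x in [set: T]) (f x)%:E <= \esum_(x in [set: T]) (g x)%:E)%E.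
Proof.
move=> g0 h; apply: ge_ereal_sup => _ [X [finX _] <-].
rewrite fsbig_finite//= sumEFin; have [C hC] := h (fset_set X).
apply: le_trans (_ : ((\sum_(x <- C) g x)%:E <= _)%E); first by rewrite lee_fin.
apply: esum_ge; exists [set` C]; first by split.
by rewrite fsbig_finite//= set_fsetK sumEFin.
Qed.

(** Abel summation. The increments of [g] may have any sign, so it takes a sum
    over a whole level set to obtain a function of the sizes of level sets. *)
Lemma sum_level u (g : R -> R) (r : R) (a : seq R) : admissible u ->
  0 < r -> path <%R 0 a -> g 0 = 0 -> (forall z, z \in a -> r <= z) ->
  (forall x, x \in level u r -> u x \in a) ->
  \sum_(x <- level u r) g (u x) =
  \sum_(i < size a) (g (nth 0 a i) - g (nth 0 (0 :: a) i)) *+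
     #|` level u (nth 0 a i)|.
Proof.
move=> au r0 pa g0 ra ua.
transitivity (\sum_(x <- level u r) \sum_(i < size a)
    (g (nth 0 a i) - g (nth 0 (0 :: a) i)) *+ (nth 0 a i <= u x)%R).
  rewrite big_seq [RHS]big_seq; apply: eq_bigr => x xl.
  have [c [_ hc ->]] := telescope_chain pa (admissible_ge0 au x).
  by rewrite g0 subr0 hc// inE ua ?orbT.
rewrite exchange_big; apply: eq_bigr => i _; rewrite sumrMnr; congr (_ *+ _).
have ri : r <= nth 0 a i by apply: ra; exact: mem_nth.
rewrite sum_nat_fset; congr #|` _|; apply/fsetP => x; rewrite !inE /=.
rewrite !in_level//; last by lra.
by apply: andb_idl; exact: le_trans.
Qed.

Lemma positive_lower_bound (u : T -> R) (s : seq T) :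
  exists2 r, 0 < r & forall x, x \in s -> 0 < u x -> r <= u x.
Proof.
elim: s => [|y s [r r0 h]]; first by exists 1.
have [y0|y0] := ltP 0 (u y); last first.
  by exists r => // x; rewrite inE => /orP[/eqP->|/h//]; lra.
exists (Num.min r (u y)); first by rewrite lt_min r0.
by move=> x; rewrite inE ge_min => /orP[/eqP->|/h{}h /h ->//]; rewrite lexx orbT.
Qed.

(** Only the positive values of [u] on a finite set matter, and they lie in a
    level set, on which the sum is a function of the sizes of level sets. *)
Lemma le_esum_equimeasurable u u' (g : R -> R) :
  admissible u -> admissible u' ->
  (forall t, 0 < t -> #|` level u t| = #|` level u' t|) ->
  g 0 = 0 -> (forall t, 0 <= t -> 0 <= g t) ->
  (\esum_(x in [set: T]) (g (u x))%:E <= \esum_(x in [set: T]) (g (u' x))%:E)%E.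
Proof.
move=> au au' e g0 gp; apply: le_esum_fset => [x|B].
  exact/gp/admissible_ge0.
have [r r0 hr] := positive_lower_bound u B.
exists (level u' r).
have [a pa ha] := increasing_enum
  ([seq u x | x <- level u r] ++ [seq u' x | x <- level u' r]).
have ra z : z \in a -> r <= z.
  rewrite ha mem_cat => /andP[_ /orP[]] /mapP[x xl ->]; move: xl;
    by rewrite in_level.
rewrite (@sum_level u' _ r a)//; last first.
  move=> x xl; rewrite ha mem_cat (map_f u' xl) orbT andbT.
  by move: xl; rewrite in_level// => /(lt_le_trans r0).
under [leRHS]eq_bigr => i _.
  rewrite -e; last by apply: lt_le_trans r0 _; apply: ra; exact: mem_nth.
  over.
rewrite -(@sum_level u _ r a)//; last first.
  move=> x xl; rewrite ha mem_cat (map_f u xl) andbT.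
  by move: xl; rewrite in_level// => /(lt_le_trans r0).
apply: le_trans (_ : \sum_(x <- [fset x in B | r <= u x]%fset) g (u x) <= _).
  rewrite -big_fset_condE [leRHS]big_mkcond big_seq [leRHS]big_seq.
  apply: ler_sum => x xB; case: (leP r (u x)) => // xr.
  have [x0|x0] := ltP 0 (u x); first by have := hr _ xB x0; rewrite leNgt xr.
  have -> : u x = 0 by apply/eqP; rewrite eq_le x0 admissible_ge0.
  by rewrite g0.
apply: le_sum_fset => [|x]; last exact/gp/admissible_ge0.
by apply/fsubsetP => x; rewrite !inE in_level// => /andP[].
Qed.

Section Supermodular.
Variable F : R -> R -> R.
Hypothesis supF : supermodular F.
Hypothesis F0s : forall s, F 0 s = 0.
Hypothesis Fs0 : forall s, F s 0 = 0.

Lemma supermodular_le s s' t t' : 0 <= s <= s' -> 0 <= t <= t' ->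
  F s t' + F s' t <= F s' t' + F s t.
Proof.
move=> /andP[s0 ss] /andP[t0 tt].
have := @supF s t (s' - s) (t' - t) s0 t0.
by rewrite !subr_ge0 ss tt !subrKC => ->.
Qed.

(** Supermodularity compares the increments in one variable with those along the
    axis, which are zero. *)
Lemma supermodular_monotone s s' t t' : 0 <= s <= s' -> 0 <= t <= t' ->
  F s t <= F s' t'.
Proof.
move=> /andP[s0 ss] /andP[t0 tt].
have := @supermodular_le 0 s t t'; have := @supermodular_le s s' 0 t'.
rewrite !F0s !Fs0 !lexx s0 t0 ss tt (le_trans t0 tt) => /(_ isT isT) + /(_ isT isT).
by lra.
Qed.

(** The function [L] below is [F] rounded down to the grid of the values of [u]
    and [v] on the finite set [B]. It agrees with [F] at these values, is below
    [F] at nonnegative arguments, and is a combination of indicators of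
    quadrants whose coefficients [D], the mixed differences of [F], are
    nonnegative. *)
Lemma le_esum_supermodular u v u' v' :
  admissible u -> admissible v -> admissible u' -> admissible v' ->
  (forall s t, 0 < s -> 0 < t ->
    (#|` level u s `&` level v t| <= #|` level u' s `&` level v' t|)%N%fset) ->
  (\esum_(x in [set: T]) (F (u x) (v x))%:E <=
   \esum_(x in [set: T]) (F (u' x) (v' x))%:E)%E.
Proof.
move=> au av au' av' hc.
have Fge0 s t : 0 <= s -> 0 <= t -> 0 <= F s t.
  move=> s0 t0; have := @supermodular_monotone 0 s 0 t.
  by rewrite F0s lexx => ->.
apply: le_esum_fset => [x|B]; first by apply: Fge0; exact: admissible_ge0.
have [a pa ha] := increasing_enum [seq u x | x <- B].
have [b pb hb] := increasing_enum [seq v x | x <- B].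
pose D i j := F (nth 0 a i) (nth 0 b j) - F (nth 0 (0 :: a) i) (nth 0 b j)
  - (F (nth 0 a i) (nth 0 (0 :: b) j)
     - F (nth 0 (0 :: a) i) (nth 0 (0 :: b) j)).
have chain_le (c : seq R) i : path <%R 0 c -> (i < size c)%N ->
    0 <= nth 0 (0 :: c) i <= nth 0 c i.
  move=> pc ic; have := pathP 0 pc => /(_ i ic) /ltW ->; rewrite andbT.
  case: i ic => [//|i ic] /=.
  have := order_path_min lt_trans pc => /allP /(_ _ (mem_nth 0 (ltnW ic))).
  exact: ltW.
have D0 i j : (i < size a)%N -> (j < size b)%N -> 0 <= D i j.
  move=> ia jb.
  have := supermodular_le (chain_le _ _ pa ia) (chain_le _ _ pb jb).
  by rewrite /D; lra.
pose L s t := \sum_(i < size a) \sum_(j < size b)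
   D i j *+ ((nth 0 a i <= s) && (nth 0 b j <= t))%R.
have LE s t : 0 <= s -> 0 <= t -> exists c c', [/\ 0 <= c <= s, 0 <= c' <= t,
    s \in 0 :: a -> c = s, t \in 0 :: b -> c' = t & L s t = F c c'].
  move=> s0 t0.
  have [c [cs hs hc1]] := telescope_chain pa s0.
  have [c' [ct ht hc2]] := telescope_chain pb t0.
  exists c, c'; split=> //.
  transitivity (\sum_(i < size a) (F (nth 0 a i) c' - F (nth 0 (0 :: a) i) c') *+
      (nth 0 a i <= s)%R); last by rewrite (hc1 (F^~ c')) F0s subr0.
  apply: eq_bigr => i _; case: (nth 0 a i <= s) => /=; last first.
    by rewrite big1.
  rewrite mulr1n -[RHS]subr0 -[X in _ - X](subrr 0).
  rewrite -[X in _ - (X - _)](Fs0 (nth 0 a i)).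
  rewrite -[X in _ - (_ - X)](Fs0 (nth 0 (0 :: a) i)).
  by rewrite -(hc2 (fun t => F (nth 0 a i) t - F (nth 0 (0 :: a) i) t)).
pose C := (\bigcup_(i <- iota 0 (size a)) level u' (nth 0 a i))%fset.
exists C.
have sumL (f g : T -> R) (A : {fset T}) : \sum_(x <- A) L (f x) (g x) =
    \sum_(i < size a) \sum_(j < size b) D i j *+
       #|` [fset x in A | (nth 0 a i <= f x) && (nth 0 b j <= g x)]%fset|.
  rewrite /L exchange_big; apply: eq_bigr => i _.
  rewrite exchange_big; apply: eq_bigr => j _.
  by rewrite sumrMnr sum_nat_fset.
apply: le_trans (_ : \sum_(x <- B) L (u x) (v x) <= _).
  rewrite big_seq [leRHS]big_seq; apply: ler_sum => x xB.
  have u0 := admissible_ge0 au x; have v0 := admissible_ge0 av x.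
  have [c [c' [_ _ hcc hcc' ->]]] := LE _ _ u0 v0.
  rewrite hcc ?hcc'// inE.
    have := v0; rewrite le_eqVlt eq_sym hb (map_f v xB) andbT.
    by move=> /orP[->//|->]; rewrite orbT.
  have := u0; rewrite le_eqVlt eq_sym ha (map_f u xB) andbT.
  by move=> /orP[->//|->]; rewrite orbT.
apply: le_trans (_ : \sum_(x <- C) L (u' x) (v' x) <= _); last first.
  apply: ler_sum => x _.
  have [c [c' [h1 h2 _ _ ->]]] :=
    LE _ _ (admissible_ge0 au' x) (admissible_ge0 av' x).
  exact: supermodular_monotone.
rewrite !sumL; apply: ler_sum => i _; apply: ler_sum => j _.
apply: ler_wpMn2l; first exact: D0.
have a0 : 0 < nth 0 a i.
  by have := mem_nth 0 (ltn_ord i); rewrite ha => /andP[].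
have b0 : 0 < nth 0 b j.
  by have := mem_nth 0 (ltn_ord j); rewrite hb => /andP[].
apply: leq_trans (leq_trans (hc _ _ a0 b0) _); apply: fsubset_leq_card;
  apply/fsubsetP => x; rewrite !inE !in_level//=.
  by case/andP.
move=> /andP[h1 h2]; rewrite h1 h2 !andbT.
apply/bigfcupP; exists (i : nat); last by rewrite in_level.
by rewrite mem_iota /= add0n ltn_ord.
Qed.

End Supermodular.

Lemma le_esum_rearranged (G : R -> R -> R) u v u' v' :
  (forall s t : R, 0 <= s -> 0 <= t -> 0 <= G s t) ->
  supermodular G -> G 0 0 = 0 ->
  admissible u -> admissible v -> admissible u' -> admissible v' ->
  (forall s, 0 < s -> #|` level u s| = #|` level u' s|) ->
  (forall t, 0 < t -> #|` level v t| = #|` level v' t|) ->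
  (forall s t, 0 < s -> 0 < t ->
    (#|` level u s `&` level v t| <= #|` level u' s `&` level v' t|)%N%fset) ->
  (\esum_(x in [set: T]) (G (u x) (v x))%:E <=
   \esum_(x in [set: T]) (G (u' x) (v' x))%:E)%E.
Proof.
move=> G0 supG G00 au av au' av' hu hv huv.
pose F s t := G s t - G s 0 - G 0 t.
have supF : supermodular F.
  move=> s t s0 t0 hs ht hs0 ht0; have := supG s t s0 t0 hs ht hs0 ht0.
  by rewrite /F; lra.
have F0s s : F 0 s = 0 by rewrite /F G00; lra.
have Fs0 s : F s 0 = 0 by rewrite /F G00; lra.
have Fp s t : 0 <= s -> 0 <= t -> 0 <= F s t.
  move=> s0 t0; have := @supermodular_monotone F supF F0s Fs0 0 s 0 t.
  by rewrite F0s lexx => ->.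
have dec f g : admissible f -> admissible g ->
  (\esum_(x in [set: T]) (G (f x) (g x))%:E =
   \esum_(x in [set: T]) (F (f x) (g x))%:E +
   (\esum_(x in [set: T]) (G (f x) 0)%:E +
    \esum_(x in [set: T]) (G 0 (g x))%:E))%E.
  move=> af ag.
  have f0 := admissible_ge0 af; have g0 := admissible_ge0 ag.
  rewrite -[X in (_ + X)%E]esumD; last 2 first.
  - by move=> x _; rewrite lee_fin G0 ?f0.
  - by move=> x _; rewrite lee_fin G0 ?g0.
  rewrite -esumD; last 2 first.
  - by move=> x _; rewrite lee_fin Fp ?f0 ?g0.
  - by move=> x _; rewrite -EFinD lee_fin addr_ge0 ?G0 ?f0 ?g0.
  by apply: eq_esum => x _; rewrite -!EFinD /F; congr _%:E; lra.
rewrite (dec _ _ au av) (dec _ _ au' av'); apply: leeD.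
  exact: le_esum_supermodular.
apply: leeD.
  by apply: (@le_esum_equimeasurable u u' (fun s => G s 0)) => // s s0; exact: G0.
by apply: (@le_esum_equimeasurable v v' (fun s => G 0 s)) => // s s0; exact: G0.
Qed.

(** Only finite sums can be compared strictly: the common part of both sums is
    finite because the larger sum is. *)
Lemma lt_esum_pair (f g : T -> R) (x y : T) : x != y ->
  (forall z, 0 <= f z) -> (forall z, 0 <= g z) ->
  (forall z, z != x -> z != y -> f z = g z) -> f x + f y < g x + g y ->
  (\esum_(z in [set: T]) (g z)%:E < +oo)%E ->
  (\esum_(z in [set: T]) (f z)%:E < \esum_(z in [set: T]) (g z)%:E)%E.
Proof.
move=> xy f0 g0 fg lt; set P := [set z | z = x \/ z = y].
have PE : P = [set` [fset x; y]%fset].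
  apply/seteqP; split=> z /=; rewrite !inE.
    by move=> [->|->]; rewrite eqxx ?orbT.
  by move=> /orP[]/eqP ->; [left|right].
have split (h : T -> R) : (forall z, 0 <= h z) ->
    (\esum_(z in [set: T]) (h z)%:E =
     (h x + h y)%:E + \esum_(z in ~` P) (h z)%:E)%E.
  move=> h0; rewrite (esumID P) ?setTI; last by move=> z _; rewrite lee_fin.
  congr (_ + _)%E; rewrite PE esum_fset//; last by move=> z _; rewrite lee_fin.
  rewrite fsbig_finite//= set_fsetK big_fsetU1 ?inE//= big_seq_fset1.
  by rewrite EFinD.
rewrite !split//.
have -> : (\esum_(z in ~` P) (f z)%:E = \esum_(z in ~` P) (g z)%:E)%E.
  apply: eq_esum => z /= Pz; rewrite fg //; apply/eqP => e; apply: Pz;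
    rewrite /P /= e; auto.
move=> fin; rewrite lteD2rE ?lte_fin//.
rewrite ge0_fin_numE; last by apply: esum_ge0 => z _; rewrite lee_fin.
by apply: le_lt_trans fin; rewrite leeDr// lee_fin addr_ge0.
Qed.

End LayerCake.

(** * Exchanging two values *)

Section Swap.
Variable T : choiceType.
Implicit Types (x y z : T).

Definition swap x y z : T := if z == x then y else if z == y then x else z.

Lemma swapK x y : involutive (swap x y).
Proof.
move=> z; rewrite /swap; have [->|zx] := eqVneq z x.
  by rewrite eqxx; case: eqP.
have [->|zy] := eqVneq z y; first by rewrite eqxx.
by rewrite (negbTE zx) (negbTE zy).
Qed.

Lemma card_swap x y (A B : {fset T}) :
  (forall z, (z \in B) = (swap x y z \in A)) -> #|` B| = #|` A|.
Proof.
move=> h; have -> : B = [fset swap x y z | z in A]%fset.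
  apply/fsetP => z; rewrite h; apply/idP/imfsetP => [zA|[w /= wA ->]].
    by exists (swap x y z); rewrite ?swapK.
  by rewrite swapK.
by rewrite card_imfset//; exact: inv_inj (swapK x y).
Qed.

Lemma admissible_swap (R : realType) (v : T -> R) x y :
  admissible v -> admissible (v \o swap x y).
Proof.
move=> [v0 fin]; split=> [z|t t0]; first exact: v0.
apply: (sub_finite_set _ (finite_image (swap x y) (fin t t0))) => z /= h.
by exists (swap x y z); rewrite ?swapK.
Qed.

Lemma rearr_set_swap (line : rel T) rank (A B : {fset T}) x y :
  ranking line rank -> line x y ->
  (forall z, (z \in B) = (swap x y z \in A)) ->
  rearr_set line rank B = rearr_set line rank A.
Proof.
move=> rk l h; apply: (rearr_set_eq rk) => w; apply: (@card_swap x y) => z.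
rewrite !in_line_part h; congr (_ && _).
have tr a : line a x = line a y.
  by rewrite !(line_sym rk a); exact: (line_left rk).
by rewrite /swap; case: eqVneq => [->//|_]; case: eqVneq => [->//|].
Qed.

End Swap.

(** * Strictly decreasing largest values *)

Section DistinctValues.
Variables (R : realType) (T : choiceType) (u : T -> R).
Hypothesis au : admissible u.
Hypothesis dec : forall n : nat, (1 <= n)%N ->
  nth_largest [set: T] u n.+1 < nth_largest [set: T] u n.

Let le_nth n t : 0 < t ->
  (t <= nth_largest [set: T] u n.+1) = (n < #|` level u t|)%N.
Proof.
move=> t0; rewrite le_nth_largest//; congr (_ < #|` _|)%N.
by apply/fsetP => x; rewrite !inE /= in_setT andbT.
Qed.

Let nth_gt0 n : 0 < nth_largest [set: T] u n.+1.
Proof. exact: le_lt_trans (nth_largest_ge0 _ _ au) (dec (ltn0Sn n)). Qed.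

Lemma level_unbounded n : exists2 t, 0 < t & (n < #|` level u t|)%N.
Proof.
exists (nth_largest [set: T] u n.+1); first exact: nth_gt0.
by rewrite -le_nth; [exact: lexx|exact: nth_gt0].
Qed.

(** Let [t] be a value taken at [x] and [y], and let [m + 2] be the size of its
    level set. Then the largest value number [m + 2] is at least [t], so number
    [m + 1] is above [t]; but [u] is above [t] at [m] points at most. *)
Lemma distinct_values x y : 0 < u x -> u x = u y -> x = y.
Proof.
move=> x0 e; apply/eqP/negPn/negP => xy.
pose t := u x; rewrite -/t in x0 e.
have xl : x \in level u t by rewrite in_level.
have yl : y \in (level u t `\ x)%fset.
  by rewrite in_fsetD1 eq_sym xy in_level//= e lexx.
have c2 : #|` level u t| = (#|` level u t `\ x `\ y|.+2)%fset.
  by rewrite (cardfsD1 x) xl (cardfsD1 y (_ `\ x)%fset) yl.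
set m := (#|` level u t `\ x `\ y|)%fset in c2.
have h1 : t <= nth_largest [set: T] u m.+2 by rewrite le_nth// c2.
have h2 : t < nth_largest [set: T] u m.+1 by exact: le_lt_trans h1 (dec _).
have r0 := lt_trans x0 h2.
have : (m < #|` level u (nth_largest [set: T] u m.+1)|)%N by rewrite -le_nth.
apply/negP; rewrite -leqNgt; apply: fsubset_leq_card.
apply/fsubsetP => z; rewrite !inE !in_level// => zr.
have tz : t < u z by exact: lt_le_trans zr.
rewrite (ltW tz) andbT; apply/andP; split.
  by apply/eqP => zy; rewrite zy -e ltxx in tz.
by apply/eqP => zx; rewrite zx ltxx in tz.
Qed.

End DistinctValues.

(** * Moves towards the centre *)

Section Exhaustion.
Variables (R : realType) (d : nat).
Implicit Types (x y : 'rV[int]_d) (i j : 'I_d).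

Lemma sq_lt_line (N c a b : int) : 0 < c -> 2 * c < N -> `|a| < `|b| ->
  (N * a - c) ^+ 2 < (N * b - c) ^+ 2.
Proof.
move=> c0 cN ab.
have h : `|N * a - c| < `|N * b - c|.
  have N0 : 0 < N by lia.
  have h1 : `|N * a - c| <= N * `|a| + c.
    apply: le_trans (ler_normB _ _) _; rewrite normrM (gtr0_norm N0) (gtr0_norm c0).
    exact: lexx.
  have h2 : N * `|b| - c <= `|N * b - c|.
    apply: le_trans (lerB_dist _ _); rewrite normrM (gtr0_norm N0) (gtr0_norm c0).
    exact: lexx.
  have h3 : N * (`|a| + 1) <= N * `|b| by rewrite ler_pM2l//; lia.
  rewrite mulrDr mulr1 in h3; lia.
by rewrite -[X in X < _]real_normK ?num_real// -[X in _ < X]real_normK ?num_real//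
  ltr_pXn2r ?nnegrE.
Qed.

Definition update y i (a : int) : 'rV[int]_d :=
  \row_j (if j == i then a else y 0 j).

Lemma pole_bounds i : 0 < (pole d) 0 i <= d%:Z.
Proof. by rewrite mxE; have := ltn_ord i; lia. Qed.

Let sqr x i := (scale d * x 0 i - pole d 0 i) ^+ 2.

Let sqdist_sum x : (sqdist x)%:Z = \sum_i sqr x i.
Proof.
rewrite /sqdist (big_morph Posz PoszD (erefl _)); apply: eq_bigr => j _.
by rewrite -mulnn PoszM !abszE -normrM -expr2 ger0_norm ?sqr_ge0.
Qed.

Variable S : set 'rV[int]_d.
Hypothesis closed_S : forall (e : 'rV[R]_d) x y, directions e -> line e x y ->
  (rank e x < rank e y)%N -> S y -> S x.

Let closed_sqdist (e : 'rV[R]_d) x y : directions e -> line_class e x y ->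
  (sqdist x)%:Z < (sqdist y)%:Z -> S y -> S x.
Proof.
move=> de /asboolP l ph Sy; have [f [k dir]] := directionsP de.
have [r|r|r] := ltngtP (rank e x) (rank e y).
- exact: closed_S r Sy.
- have l2 : line e y x by rewrite (line_sym (ranking_line dir)).
  by have := sqdist_rank dir l2 r; lia.
- by move: ph; rewrite (rank_inj (ranking_line dir) l r) ltxx.
Qed.

Lemma coordinate_move y i a : `|a| < `|y 0 i| -> S y -> S (update y i a).
Proof.
move=> ay; apply: (@closed_sqdist (unit_vec R i)).
- by left; exists i.
- exists (a - y 0 i)%:~R; apply/matrixP => b j; rewrite !ord1 !mxE eqxx /=.
  by case: eqVneq => [->|_]; rewrite ?subrr ?mulr1 ?mulr0.
- rewrite !sqdist_sum !(bigD1 i isT) /= (eq_bigr (sqr y)).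
    rewrite ltrD2r /sqr mxE eqxx; have := pole_bounds i => cb.
    by apply: sq_lt_line => //; rewrite /scale; lia.
  by move=> j ji; rewrite /sqr mxE (negbTE ji).
Qed.

Lemma sq_lt_diagonal (N c c' b m : int) : 0 < c -> 0 < c' -> c + c' < N ->
  m != 0 -> `|m| < `|b| ->
  (N * (b - Num.sg b * `|m|) - c) ^+ 2 + (N * m - c') ^+ 2 <
  (N * b - c) ^+ 2 + (N * 0 - c') ^+ 2.
Proof.
move=> c0 c0' cN m0 mb; rewrite -subr_gt0.
have N0 : 0 < N by lia.
have a0 : 0 < `|m| by rewrite normr_gt0.
(* The difference of the two sides is the product below, where k is one of the
   four numbers + c + c', + c - c', - c + c', - c - c' according to the signs
   of b and m. *)
have pos k : - (c + c') <= k -> 0 < (2 * N * `|m|) * (N * (`|b| - `|m|) + k).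
  move=> hk; apply: mulr_gt0; first by rewrite mulr_gt0// mulr_gt0.
  have : N * 1 <= N * (`|b| - `|m|) by rewrite ler_pM2l//; lia.
  by rewrite mulr1; set X := N * _; lia.
have [b0|b0|b0] := ltrgtP b 0; last by rewrite b0 normr0 in mb; lia.
- have [n0|n0|n0] := ltrgtP m 0; last by rewrite n0 eqxx in m0.
    rewrite [ltRHS](_ : _ = 2 * N * `|m| * (N * (`|b| - `|m|) + (c - c'))).
      by apply: pos; lia.
    by rewrite ltr0_sg// (ltr0_norm b0) (ltr0_norm n0); ring.
  rewrite [ltRHS](_ : _ = 2 * N * `|m| * (N * (`|b| - `|m|) + (c + c'))).
    by apply: pos; lia.
  by rewrite ltr0_sg// (ltr0_norm b0) (gtr0_norm n0); ring.
- have [n0|n0|n0] := ltrgtP m 0; last by rewrite n0 eqxx in m0.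
    rewrite [ltRHS](_ : _ = 2 * N * `|m| * (N * (`|b| - `|m|) + (- c - c'))).
      by apply: pos; lia.
    by rewrite gtr0_sg// (gtr0_norm b0) (ltr0_norm n0); ring.
  rewrite [ltRHS](_ : _ = 2 * N * `|m| * (N * (`|b| - `|m|) + (- c + c'))).
    by apply: pos; lia.
  by rewrite gtr0_sg// (gtr0_norm b0) (gtr0_norm n0); ring.
Qed.

Lemma diagonal_direction i j (t m : int) : i != j -> t = m \/ t = - m ->
  exists2 e : 'rV[R]_d, directions e & exists c : R,
    to_real R (t *: delta_mx 0 i + m *: delta_mx 0 j) = c *: e.
Proof.
move=> ij tm; rewrite /to_real map_mxD !map_mxZ !map_delta_mx.
have h2 (k : int) : 2 * k%:~R * 2^-1 = k%:~R :> R by field.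
have [l|l] : (i < j)%N \/ (j < i)%N.
  have [?|?|/val_inj e] := ltngtP i j; [by left|by right|].
  by rewrite e eqxx in ij.
all: case: tm => ->.
- exists (2^-1 *: (unit_vec R i + unit_vec R j)).
    by right; exists i, j; split => //; left.
  by exists (2 * m%:~R); rewrite scalerA h2 scalerDr.
- exists (2^-1 *: (unit_vec R i - unit_vec R j)).
    by right; exists i, j; split => //; right.
  exists (2 * (- m)%:~R); rewrite scalerA h2 scalerBr.
  by rewrite /= !mulrNz !scaleNr opprK.
- exists (2^-1 *: (unit_vec R j + unit_vec R i)).
    by right; exists j, i; split => //; left.
  by exists (2 * m%:~R); rewrite scalerA h2 scalerDr addrC.
- exists (2^-1 *: (unit_vec R j - unit_vec R i)).
    by right; exists j, i; split => //; right.
  by exists (2 * m%:~R); rewrite scalerA h2 scalerBr /= mulrNz scaleNr addrC.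
Qed.

(** A large coordinate can pay for any prescribed value in a coordinate that is
    zero, by moving along a diagonal direction. *)
Lemma diagonal_move y i j (m : int) : i != j -> y 0 j = 0 -> m != 0 ->
  `|m| < `|y 0 i| -> S y ->
  S (update (update y i (y 0 i - Num.sg (y 0 i) * `|m|)) j m).
Proof.
move=> ij yj m0 my; set z := update _ j m.
have ji : j != i by rewrite eq_sym.
pose t := - (Num.sg (y 0 i) * `|m|).
have tm : t = m \/ t = - m.
  rewrite /t; have [b0|b0|b0] := ltrgtP (y 0 i) 0.
  - rewrite ltr0_sg//; lia.
  - rewrite gtr0_sg//; lia.
  - by rewrite b0 normr0 in my; lia.
have zi : z 0 i = y 0 i + t by rewrite !mxE (negbTE ij) eqxx.
have zj : z 0 j = m by rewrite !mxE eqxx.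
have zl l : l != i -> l != j -> z 0 l = y 0 l.
  by move=> li lj; rewrite !mxE (negbTE li) (negbTE lj).
have [e de [c hc]] := diagonal_direction ij tm.
apply: (closed_sqdist de).
  exists c; rewrite -hc; congr map_mx; apply/matrixP => a l; rewrite ord1.
  have -> : (z - y) 0 l = z 0 l - y 0 l by rewrite mxE [(- y) _ _]mxE.
  rewrite ![in RHS]mxE eqxx /=; have [->|li] := eqVneq l i.
    by rewrite zi (negbTE ij) /= mulr1 mulr0 addr0 addrAC subrr add0r.
  have [->|lj] := eqVneq l j.
    by rewrite zj yj /= mulr1 mulr0 add0r subr0.
  by rewrite zl// subrr !mulr0 addr0.
have dec w : (sqdist w)%:Z =
    sqr w i + (sqr w j + \sum_(l | (l != i) && (l != j)) sqr w l).
  by rewrite sqdist_sum (bigD1 i)//= (bigD1 j).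
rewrite !dec.
rewrite (eq_bigr (sqr y)) => [|l /andP[li lj]]; last by rewrite /sqr zl.
rewrite !addrA ltrD2r /sqr zi zj yj.
have := ltn_ord i; have := ltn_ord j; have : (i != j :> nat) by [].
have := pole_bounds i; have := pole_bounds j => hj hi nij jd id.
apply: sq_lt_diagonal => //; [lia|lia|].
by rewrite /scale; lia.
Qed.

(** Starting from a point with a large coordinate [i], the other coordinates are
    set one after the other: first to 0 along a coordinate line, then to that of
    [x] along a diagonal. Each time the coordinate [i] loses at most the bound
    [B] on the entries of [x]; in the end it is moved to that of [x]. *)
Lemma exhaustion x : exists M : int, forall y i, M <= `|y 0 i| -> S y -> S x.
Proof.
pose B := \sum_j `|x 0 j|.
have xB j : `|x 0 j| <= B by rewrite /B (bigD1 j)//= lerDl sumr_ge0.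
exists ((size (enum 'I_d)).+1%:Z * B + 1) => y i.
have : forall j, j != i -> j \notin enum 'I_d -> y 0 j = x 0 j.
  by move=> j _; rewrite mem_enum.
elim: (enum 'I_d) y => [|j s IH] y ys yM Sy.
  have -> : x = update y i (x 0 i).
    apply/matrixP => a l; rewrite !ord1 mxE; case: eqVneq => [->//|li].
    by rewrite ys.
  apply: coordinate_move => //; have := xB i; move: yM; rewrite mul1r; lia.
have B0 : 0 <= B by rewrite sumr_ge0.
have yM' : (size s).+1%:Z * B + B + 1 <= `|y 0 i|.
  by move: yM; rewrite /= -addn1 PoszD mulrDl mul1r.
have yM1 : (size s).+1%:Z * B + 1 <= `|y 0 i| by lia.
have sB0 : 0 <= (size s).+1%:Z * B by rewrite mulr_ge0.
have [e|ji] := eqVneq j i.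
  apply: (IH y) => // l li ls; apply: ys => //.
  by rewrite inE negb_or ls e li.
have [e|yx] := eqVneq (y 0 j) (x 0 j).
  apply: (IH y) => // l li ls; have [->//|lj] := eqVneq l j.
  by apply: ys => //; rewrite inE negb_or lj.
have Sz : S (update y j 0).
  have [e|y0] := eqVneq (y 0 j) 0.
    rewrite (_ : update y j 0 = y)//; apply/matrixP => a l; rewrite ord1 mxE.
    by case: eqVneq => [->|//].
  by apply: coordinate_move => //; rewrite normr0 normr_gt0.
have ij : i != j by rewrite eq_sym.
have zi : (update y j 0) 0 i = y 0 i by rewrite mxE (negbTE ij).
have [xj|xj] := eqVneq (x 0 j) 0.
  apply: (IH (update y j 0)) => // [l li ls|]; last by rewrite zi.
  rewrite mxE; have [->|lj] := eqVneq l j; first by rewrite xj.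
  by apply: ys => //; rewrite inE negb_or lj.
have xi : `|x 0 j| < `|y 0 i| by have := xB j; lia.
have := @diagonal_move (update y j 0) i j (x 0 j) ij.
rewrite zi mxE eqxx => /(_ erefl xj xi Sz); apply: IH => [l li ls|].
  rewrite !mxE; have [->//|lj] := eqVneq l j; rewrite (negbTE li).
  by apply: ys => //; rewrite inE negb_or lj.
rewrite !mxE (negbTE ij) eqxx; have := xB j; move: xi.
have [b0|b0|b0] := ltrgtP (y 0 i) 0.
- rewrite ltr0_sg//; lia.
- rewrite gtr0_sg//; lia.
- by rewrite b0 normr0; lia.
Qed.

End Exhaustion.

(** * The equality case *)

Lemma finite_box (d : nat) (N : int) :
  finite_set [set y : 'rV[int]_d | forall i, `|y 0 i| < N].
Proof.
pose n := `|N|%N.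
pose g (h : {ffun 'I_d -> 'I_(2 * n).+1}) : 'rV[int]_d :=
  \row_i ((h i)%:Z - n%:Z).
have fin : finite_set [set: {ffun 'I_d -> 'I_(2 * n).+1}] by exact: finite_finset.
apply: sub_finite_set (finite_image g fin) => y /= hy.
exists [ffun i => inord `|(y 0 i + n%:Z)%R|%N] => //.
apply/matrixP => a i; rewrite ord1 mxE ffunE inordK.
  by have := hy i; rewrite /n; lia.
by have := hy i; rewrite /n; lia.
Qed.

Section Equality.
Variables (R : realType) (d : nat) (E : seq 'rV[R]_d).
Hypothesis d_gt0 : (0 < d)%N.
Hypothesis dirsE : enumerates_directions E.
Implicit Types u v : 'rV[int]_d -> R.

(** The support of [u] is infinite, hence it contains points with arbitrarily
    large coordinates, and [exhaustion] applies to it. *)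
Lemma symmetric_gt0 u : admissible u -> u = schwarz E u ->
  (forall n : nat, (1 <= n)%N ->
     nth_largest [set: 'rV[int]_d] u n.+1 < nth_largest [set: 'rV[int]_d] u n) ->
  forall x, 0 < u x.
Proof.
move=> au us dec x.
have clS (e : 'rV[R]_d) y z : directions e -> line e y z ->
    (rank e y < rank e z)%N -> 0 < u z -> 0 < u y.
  move=> de l r; rewrite us => /lt_le_trans; apply.
  exact: (schwarz_monotone d_gt0 dirsE de au l r).
have [M hM] := @exhaustion R d (fun z => 0 < u z) clS x.
pose box := [set y : 'rV[int]_d | forall i, `|y 0 i| < M].
have [t t0] := level_unbounded au dec #|` fset_set box|.
apply: contraTT => nx; rewrite -leqNgt; apply: fsubset_leq_card.
apply/fsubsetP => y; rewrite in_level// => ty.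
rewrite in_fset_set; last exact: finite_box.
rewrite inE => i /=; rewrite ltNge.
apply: contra nx => /hM; apply; exact: lt_le_trans t0 ty.
Qed.

Lemma schwarz_iter_fixed u k : admissible u -> u = schwarz E u ->
  rearr_iter E k u = u.
Proof.
move=> au us; elim: k => //= k ->.
have de : directions (dir_at E k) by exact: directions_at.
apply: level_inj => //; first exact: admissible_rearr_step.
move=> t t0; rewrite level_rearr_step// us.
exact: level_schwarz_fixed.
Qed.

Lemma first_change v : admissible v -> v <> schwarz E v ->
  exists2 k, rearr_iter E k v = v & rearr_step (dir_at E k) v <> v.
Proof.
move=> av nv; apply: contrapT => h; apply: nv; apply/esym/schwarz_fixed => //.
elim=> // k IH; rewrite /= IH; apply: contrapT => ne; apply: h.
by exists k.
Qed.

Lemma rearr_step_fixed e v : directions e -> admissible v ->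
  (forall x y, line e x y -> (rank e x < rank e y)%N -> v y <= v x) ->
  rearr_step e v = v.
Proof.
move=> de av h; apply: level_inj => //; first exact: admissible_rearr_step.
move=> t t0; rewrite level_rearr_step//.
apply: (rearr_set_down (directions_ranking de)) => x y l r.
by rewrite !in_level// => /le_trans; apply; exact: h.
Qed.

(** The function [v'] is [v] with its values at [x] and [y] exchanged. From the
    step that modifies [v] on, its level sets can replace those of [v] in the
    comparison with the rearrangements, because that step sends both to the same
    sets. *)
Lemma lt_esum_schwarz (G : R -> R -> R) u v :
  (forall s t : R, 0 <= s -> 0 <= t -> 0 <= G s t) ->
  strictly_supermodular G -> G 0 0 = 0 ->
  admissible u -> admissible v -> u = schwarz E u ->
  (forall n : nat, (1 <= n)%N ->
     nth_largest [set: 'rV[int]_d] u n.+1 < nth_largest [set: 'rV[int]_d] u n) ->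
  (\esum_(x in [set: 'rV[int]_d]) (G (schwarz E u x) (schwarz E v x))%:E < +oo)%E ->
  v <> schwarz E v ->
  (\esum_(x in [set: 'rV[int]_d]) (G (u x) (v x))%:E <
   \esum_(x in [set: 'rV[int]_d]) (G (schwarz E u x) (schwarz E v x))%:E)%E.
Proof.
move=> G0 [supG strG] G00 au av us dec fin nv.
have [k vk ne] := first_change av nv.
set e := dir_at E k in ne.
have de : directions e by exact: directions_at.
have [x [y [l r vxy]]] : exists x y,
    [/\ line e x y, (rank e x < rank e y)%N & v x < v y].
  apply: contrapT => h; apply: ne; apply: rearr_step_fixed => // x y l r.
  by rewrite leNgt; apply/negP => lt; apply: h; exists x, y.
have xy : x != y by apply: contraTneq r => ->; rewrite ltnn.
have uxy : u y < u x.
  rewrite lt_neqAle; apply/andP; split.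
    apply: contra xy => /eqP uyx; apply/eqP/esym.
    exact: (distinct_values au dec (symmetric_gt0 au us dec y)).
  by rewrite us; exact: (schwarz_monotone d_gt0 dirsE de au l r).
pose v' := v \o swap x y.
have av' : admissible v' by exact: admissible_swap.
have lev' t z : 0 < t -> (z \in level v' t) = (swap x y z \in level v t).
  by move=> t0; rewrite !in_level.
have le : (\esum_(x in [set: 'rV[int]_d]) (G (u x) (v' x))%:E <=
   \esum_(x in [set: 'rV[int]_d]) (G (schwarz E u x) (schwarz E v x))%:E)%E.
  apply: le_esum_rearranged => //; try exact: admissible_schwarz.
  - by move=> s s0; rewrite card_level_schwarz.
  - move=> t t0.
    by rewrite card_level_schwarz//; apply: (@card_swap _ x y) => z; exact: lev'.
  move=> s t s0 t0.
  apply: leq_trans (card_levelI_iter_schwarz d_gt0 dirsE k.+1 au av s0 t0).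
  rewrite !level_iterS// schwarz_iter_fixed// vk.
  have rk := directions_ranking de.
  have swap_e : line_rearr e (level v' t) = line_rearr e (level v t).
    by apply: (rearr_set_swap rk l) => z; exact: lev'.
  rewrite -/e -swap_e.
  exact: card_rearr_setI.
apply: (lt_le_trans _ le); apply: (@lt_esum_pair _ _ _ _ x y) => //.
- by move=> z; apply: G0; exact: admissible_ge0.
- by move=> z; apply: G0; exact: admissible_ge0.
- by move=> z zx zy; rewrite /v' /= /swap (negbTE zx) (negbTE zy).
- have -> : v' x = v y by rewrite /v' /= /swap eqxx.
  have -> : v' y = v x by rewrite /v' /= /swap eqxx; case: eqVneq => [->|].
  have := strG (u y) (v x) (u x - u y) (v y - v x).
  rewrite !subr_gt0 !subrKC uxy vxy !admissible_ge0// => /(_ isT isT isT isT).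
  by lra.
- exact: le_lt_trans le fin.
Qed.

End Equality.

Theorem corollary5p11 (R : realType) (d : nat) (E : seq 'rV[R]_d)
    (u v : 'rV[int]_d -> R) (G : R -> R -> R)
    (hd : (1 <= d)%N) (hE : enumerates_directions E)
    (hu : admissible u) (hv : admissible v)
    (hG : forall s t : R, 0 <= s -> 0 <= t -> 0 <= G s t)
    (hsup : supermodular G) (hG0 : G 0 0 = 0) :
  (\esum_(x in [set: 'rV[int]_d]) (G (u x) (v x))%:E <=
   \esum_(x in [set: 'rV[int]_d]) (G (schwarz E u x) (schwarz E v x))%:E)%E
  /\
  (u = schwarz E u ->
   (forall n : nat, (1 <= n)%N ->
      nth_largest [set: 'rV[int]_d] u n.+1 <
      nth_largest [set: 'rV[int]_d] u n) ->
   strictly_supermodular G ->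
   (`| \esum_(x in [set: 'rV[int]_d])
         (G (schwarz E u x) (schwarz E v x))%:E | < +oo)%E ->
   (\esum_(x in [set: 'rV[int]_d]) (G (u x) (v x))%:E =
    \esum_(x in [set: 'rV[int]_d]) (G (schwarz E u x) (schwarz E v x))%:E
    <-> v = schwarz E v)).
Proof.
split.
  apply: le_esum_rearranged => //; try exact: admissible_schwarz.
  - by move=> s s0; rewrite card_level_schwarz.
  - by move=> t t0; rewrite card_level_schwarz.
  - by move=> s t s0 t0; exact: (card_levelI_iter_schwarz hd hE 0).
move=> us dec strG fin; split=> [e|vs]; last by rewrite -us -vs.
apply: contrapT => nv.
have fin' := le_lt_trans (lee_abs _) fin.
by have := lt_esum_schwarz hd hE hG strG hG0 hu hv us dec fin' nv; rewrite e ltxx.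
Qed.
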